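(* Let $n\ge m\ge1$ and $L>0$. For $\mathbf{x}\in\mathbb{R}^{3(m+n)}$ define the subset $\Theta^\star(\mathbf{x})\subseteq\Gamma^\star(\mathbf{x})$ by $$\Theta^\star(\mathbf{x})=\operatorname{argmax}_{\bm{\theta}\in\Gamma^\star(\mathbf{x})}\ \sum_{ij\in A_{\bm{\theta}}}V_{ij}(\mathbf{x}_{E_i},\mathbf{x}_{P_j}),$$ and let $$\bar{L}^\star(\mathbf{x})=2\sum_{i\in M}\max_{j\in\bar{N}_i}|V_{ij}(\mathbf{x}_{E_i},\mathbf{x}_{P_j})|,\qquad \bar{N}_i=\{j\in N:\alpha_{ij}\le 1\}.$$ Starting from some $\mathbf{x}\in\mathbb{R}^{3(m+n)}$, if $L>\bar{L}^\star(\mathbf{x})$, then every $\bm{\theta}^\star\in\Theta^\star(\mathbf{x})$ ensures that $|\{ij\in A_{\bm{\theta}^\star}:\alpha_{ij}>1\}|$ is minimized, i.e. $|\{ij\in A_{\bm{\theta}^\star}:\alpha_{ij}>1\}|\le|\{ij\in A_{\bm{\mu}}:\alpha_{ij}>1\}|$ for all $\bm{\mu}\in\Gamma^\star(\mathbf{x})$.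
   Context: There are $m$ evaders $E_i$, $i\in M=\{1,\dots,m\}$, and $n$ pursuers $P_j$, $j\in N=\{1,\dots,n\}$, with positions $\mathbf{x}_{E_i},\mathbf{x}_{P_j}\in\mathbb{R}^3$, speeds $U_i,V_j>0$, and $\alpha_{ij}=U_i/V_j$; the state is $\mathbf{x}=(\mathbf{x}_{E_1},\dots,\mathbf{x}_{E_m},\mathbf{x}_{P_1},\dots,\mathbf{x}_{P_n})\in\mathbb{R}^{3(m+n)}$. Standing assumption: each pursuer can capture at most one evader and each evader is pursued by one pursuer, $n\ge m$, and pursuers commit to their assignments. Let $\mathbf{1}_k$ be the all-ones column vector of size $k$. $\Sigma=\{\bm{\mu}\in\{0,1\}^{m\times n}:\bm{\mu}\mathbf{1}_n=\mathbf{1}_m,\ \bm{\mu}^T\mathbf{1}_m\le\mathbf{1}_n\}$, $\Gamma=\{\bm{\gamma}\in[0,1]^{m\times n}:\bm{\gamma}\mathbf{1}_n=\mathbf{1}_m,\ \bm{\gamma}^T\mathbf{1}_m\le\mathbf{1}_n\}$; for $\bm{\mu}\in\Sigma$, $A_{\bm{\mu}}=\{ij\in M\times N:\mu_{ij}=1\}$. $B_{ij}(\mathbf{x}_{E_i},\mathbf{x}_{P_j})=\|\mathbf{x}_{E_i}\|^2-\alpha_{ij}^2\|\mathbf{x}_{P_j}\|^2$. When $B_{ij}>0$ and $\alpha_{ij}<1$, $\mathcal{V}^P_{ij}=\Big\|\frac{\mathbf{x}_{E_i}-\alpha_{ij}^2\mathbf{x}_{P_j}}{1-\alpha_{ij}^2}\Big\|-\frac{\alpha_{ij}}{1-\alpha_{ij}^2}\|\mathbf{x}_{P_j}-\mathbf{x}_{E_i}\|$;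 when $B_{ij}>0$ and $\alpha_{ij}=1$, $\mathcal{V}^P_{ij}=\frac{\|\mathbf{x}_{E_i}\|^2-\|\mathbf{x}_{P_j}\|^2}{2\|\mathbf{x}_{E_i}-\mathbf{x}_{P_j}\|}$. $\mathcal{V}^E_{ij}=-\|\mathbf{x}_{P_j}\|+\|\mathbf{x}_{E_i}\|/\alpha_{ij}$. $a_{ij}=\mathcal{V}^P_{ij}$ if $B_{ij}>0$ and $\alpha_{ij}\le 1$, and $a_{ij}=-L$ otherwise; $\Psi(\mathbf{x},\bm{\gamma})=\sum_{i\in M}\sum_{j\in N}a_{ij}(\mathbf{x}_{E_i},\mathbf{x}_{P_j})\gamma_{ij}$. $\Gamma^\star(\mathbf{x})$ is the set of extreme-point maximizers of $\Psi(\mathbf{x},\cdot)$ over $\Gamma$; these are elements of $\Sigma$. Value matrix: $V_{ij}(\mathbf{x}_{E_i},\mathbf{x}_{P_j})=\mathcal{V}^P_{ij}$ if $B_{ij}>0,\ \alpha_{ij}\le1$; $V_{ij}=\mathcal{V}^E_{ij}$ if $B_{ij}\le0,\ \alpha_{ij}\le1$; $V_{ij}=-L$ otherwise. A maximum over the empty set is $0$. *)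

(* Defs.v *)
From HB Require Import structures.
From mathcomp Require Import all_boot all_order all_algebra.
From mathcomp Require Import boolp classical_sets reals.
Set Implicit Arguments.
Unset Strict Implicit.
Unset Printing Implicit Defensive.
Import Order.TTheory GRing.Theory Num.Theory.
Local Open Scope classical_set_scope.
Local Open Scope ring_scope.

Section Generic.
Context {R : realType}.

(* The norm that MathComp-Analysis puts on row vectors is the sup norm. *)
Definition enorm (k : nat) (w : 'rV[R]_k) : R :=
  Num.sqrt (\sum_(l < k) w 0 l ^+ 2).

Definition ones (k : nat) : 'cV[R]_k := const_mx 1.

Definition argmax (T : Type) (C : set T) (f : T -> R) : set T :=
  [set c | C c /\ forall d, C d -> f d <= f c].

Definition extreme_points (E : lmodType R) (C : set E) : set E :=
  [set c | C c /\ forall a b t, C a -> C b -> 0 < t -> t < 1 ->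
             c = t *: a + (1 - t) *: b -> a = b].

Definition Gamma (m n : nat) : set 'M[R]_(m, n) :=
  [set g : 'M[R]_(m, n) |
    [/\ forall i j, 0 <= g i j <= 1,
        g *m ones n = ones m &
        forall j, (g^T *m ones m) j 0 <= ones n j 0]].

(* A_g; the extreme points of Gamma are 0-1 matrices, so for them this is the
   whole support. *)
Definition assigned (m n : nat) (g : 'M[R]_(m, n)) : {set 'I_m * 'I_n} :=
  [set p | g p.1 p.2 == 1].

(* B_ij, V^P_ij and V^E_ij as functions of the speed ratio a = alpha_ij, of the
   evader position e and of the pursuer position p. *)
Definition barrier (a : R) (e p : 'rV[R]_3) : R :=
  enorm e ^+ 2 - a ^+ 2 * enorm p ^+ 2.

(* Only meaningful, and only used, for 0 < barrier a e p and a <= 1. *)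
Definition valueP (a : R) (e p : 'rV[R]_3) : R :=
  if a == 1 then
    (enorm e ^+ 2 - enorm p ^+ 2) / (2 * enorm (e - p))
  else
    enorm ((1 - a ^+ 2)^-1 *: (e - a ^+ 2 *: p))
    - a / (1 - a ^+ 2) * enorm (p - e).

Definition valueE (a : R) (e p : 'rV[R]_3) : R := - enorm p + enorm e / a.

End Generic.

Section Game.
Context {R : realType} {m n : nat}.
(* Evader speeds U_i, pursuer speeds V_j, penalty L. *)
Variables (spE : 'I_m -> R) (spP : 'I_n -> R) (L : R).

Definition alpha (i : 'I_m) (j : 'I_n) : R := spE i / spP j.

(* The state stacks the m evader positions above the n pursuer positions. *)
Variable x : 'M[R]_(m + n, 3).

Definition posE (i : 'I_m) : 'rV[R]_3 := row (lshift n i) x.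
Definition posP (j : 'I_n) : 'rV[R]_3 := row (rshift m j) x.

Definition payoff (i : 'I_m) (j : 'I_n) : R :=
  if (0 < barrier (alpha i j) (posE i) (posP j)) && (alpha i j <= 1)
  then valueP (alpha i j) (posE i) (posP j)
  else - L.

Definition Psi (g : 'M[R]_(m, n)) : R :=
  \sum_(i < m) \sum_(j < n) payoff i j * g i j.

Definition Gamma_star : set 'M[R]_(m, n) :=
  extreme_points (@Gamma R m n) `&` argmax (@Gamma R m n) Psi.

Definition value (i : 'I_m) (j : 'I_n) : R :=
  if alpha i j <= 1 then
    if 0 < barrier (alpha i j) (posE i) (posP j)
    then valueP (alpha i j) (posE i) (posP j)
    else valueE (alpha i j) (posE i) (posP j)
  else - L.

Definition Theta_star : set 'M[R]_(m, n) :=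
  argmax Gamma_star (fun t => \sum_(p in assigned t) value p.1 p.2).

(* Independent of L, since only entries with alpha i j <= 1 occur; the default 0
   of the maximum is harmless because all the terms are nonnegative. *)
Definition Lbar_star : R :=
  2 * \sum_(i < m) \big[Num.max/0]_(j < n | alpha i j <= 1) `|value i j|.

Definition faster_evader_pairs (g : 'M[R]_(m, n)) : {set 'I_m * 'I_n} :=
  [set p in assigned g | 1 < alpha p.1 p.2].

End Game.

(* Main.v *)
Require Import Defs.
From mathcomp Require Import all_boot all_order all_algebra.
From mathcomp Require Import boolp classical_sets reals.
From mathcomp Require Import lra.
Import Order.TTheory GRing.Theory Num.Theory.
Local Open Scope classical_set_scope.
Local Open Scope ring_scope.

(** Every pair of an assignment whose evader is the faster player contributes
    exactly [- L] to the total value.  The remaining pairs contribute at most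
    half of [Lbar_star] in absolute value: the rows of a matrix in [Gamma] are
    nonnegative and sum to 1, so an evader has at most one assigned pursuer, and
    its contribution is at most the maximum in its row
    ([norm_sum_assigned_le]).  Hence one additional faster-evader pair lowers
    the total value by [L], whereas the other pairs can make up for at most
    [Lbar_star], which is less than [L].  A maximizer of the total value
    therefore has as few faster-evader pairs as any competitor. *)

Lemma Gamma_row_sum {R : realType} {m n : nat} {g : 'M[R]_(m, n)} i :
  Gamma g -> \sum_(j < n) g i j = 1.
Proof.
move=> [_ /matrixP/(_ i 0) + _]; rewrite !mxE => <-.
by apply: eq_bigr => j _; rewrite mxE mulr1.
Qed.

(** Two entries equal to 1 in the same row would already sum to 2. *)
Lemma Gamma_assigned_inj {R : realType} {m n : nat} {g : 'M[R]_(m, n)} {i j k} :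
  Gamma g -> g i j = 1 -> g i k = 1 -> j = k.
Proof.
move=> Gg gij gik; apply/eqP/negPn/negP => jk.
have := Gamma_row_sum i Gg; case: Gg => g01 _ _.
rewrite (bigD1 j) //= (bigD1 k) 1?eq_sym //= gij gik.
have : 0 <= \sum_(l < n | (l != j) && (l != k)) g i l.
  by apply: sumr_ge0 => l _; case/andP: (g01 i l).
by move: (\sum_(l < n | _) _) => s s_ge0 s_eq; lra.
Qed.

(** By [Gamma_assigned_inj] the row [i] has at most one term on the left, so its
    maximum, rather than its sum, is enough on the right; the default 0 accounts
    for a row without a term. *)
Lemma norm_sum_assigned_le {R : realType} {m n : nat} {g : 'M[R]_(m, n)}
    (P : 'I_m -> 'I_n -> bool) (v : 'I_m -> 'I_n -> R) :
  Gamma g ->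
  `|\sum_(p in assigned g | P p.1 p.2) v p.1 p.2|
  <= \sum_(i < m) \big[Num.max/0]_(j < n | P i j) `|v i j|.
Proof.
move=> Gg; apply: le_trans (ler_norm_sum _ _ _) _.
have -> : \sum_(p in assigned g | P p.1 p.2) `|v p.1 p.2|
    = \sum_(i < m) \sum_(j < n | (g i j == 1) && P i j) `|v i j|.
  by rewrite pair_big_dep /=; apply: eq_bigl => p; rewrite inE.
apply: ler_sum => i _.
have [j /andP[/eqP gij Pij]|none] := pickP (fun j => (g i j == 1) && P i j).
  rewrite (big_pred1 j) => [|k].
    by apply: le_bigmax_cond.
  apply/andP/eqP => [[/eqP gik _]|->]; last by rewrite gij eqxx.
  exact: Gamma_assigned_inj Gg gik gij.
by rewrite big_pred0 //; apply: bigmax_ge_id.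
Qed.

Lemma sum_value_split (R : realType) (m n : nat) (spE : 'I_m -> R)
    (spP : 'I_n -> R) (L : R) (x : 'M[R]_(m + n, 3)) (g : 'M[R]_(m, n)) :
  \sum_(p in assigned g) value spE spP L x p.1 p.2
  = \sum_(p in assigned g | alpha spE spP p.1 p.2 <= 1)
       value spE spP L x p.1 p.2
    - #|faster_evader_pairs spE spP g|%:R * L.
Proof.
rewrite (bigID (fun p => alpha spE spP p.1 p.2 <= 1)) /=; congr (_ + _).
rewrite -mulrN mulr_natl -sumr_const.
apply: eq_big => [p|p /andP[_ /negPf slowF]]; last by rewrite /value slowF.
by rewrite !inE -ltNge.
Qed.

Theorem lemma5 (R : realType) (m n : nat) (spE : 'I_m -> R) (spP : 'I_n -> R)
    (L : R) (x : 'M[R]_(m + n, 3))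
    (m_ge1 : (1 <= m)%N) (n_gem : (m <= n)%N)
    (spE_gt0 : forall i, 0 < spE i) (spP_gt0 : forall j, 0 < spP j)
    (L_gt0 : 0 < L) (L_large : Lbar_star spE spP L x < L) :
  forall theta, Theta_star spE spP L x theta ->
  forall mu, Gamma_star spE spP L x mu ->
  (#|faster_evader_pairs spE spP theta| <= #|faster_evader_pairs spE spP mu|)%N.
Proof.
move=> theta [theta_opt theta_max] mu mu_opt.
have Gtheta : Gamma theta by case: theta_opt => _ [].
have Gmu : Gamma mu by case: mu_opt => _ [].
rewrite leqNgt; apply/negP => card_lt.
have := theta_max mu mu_opt; rewrite !sum_value_split.
pose slow i j := alpha spE spP i j <= 1.
have := norm_sum_assigned_le slow (value spE spP L x) Gtheta.
have := norm_sum_assigned_le slow (value spE spP L x) Gmu.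
move: L_large; rewrite /Lbar_star /slow !ler_norml.
set half := \sum_(i < m) _; set vmu := \sum_(p in assigned mu | _) _.
set vtheta := \sum_(p in assigned theta | _) _.
set kmu := #|faster_evader_pairs _ _ mu| in card_lt *.
set ktheta := #|faster_evader_pairs _ _ theta| in card_lt *.
move=> half_lt /andP[vmu_ge _] /andP[_ vtheta_le] vmu_le.
(* [theta] has at least one penalty [L] more than [mu] *)
have : (kmu%:R + 1) * L <= ktheta%:R * L.
  by rewrite ler_pM2r // natr1 ler_nat.
by rewrite mulrDl mul1r => kL_le; lra.
Qed.
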